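(* For any virtual knot $K$, $$F(K) \geq \left\vert \tfrac{1}{2}w_o(K)\right\vert,$$ where $F(K)$ is the forbidden number of $K$ and $w_o(K)$ is the odd writhe of $K$.
   Context: A virtual knot is an equivalence class of (oriented) virtual knot diagrams, with classical and virtual crossings, modulo the extended Reidemeister moves: the classical moves $R1,R2,R3$, the virtual moves $V1,V2,V3$ and the semivirtual move $SV$. The Gauss diagram of a diagram is an oriented circle with one signed arrow (chord) per classical crossing; the two endpoints of the arrow are the two passages through that crossing, the arrow points from the overcrossing (tail) to the undercrossing (head), and it carries the sign $\pm1$ of the crossing. Virtual knots correspond to Gauss diagrams modulo the Gauss diagram versions of $R1,R2,R3$. The forbidden moves: $FO$ moves a strand of the diagram over a virtual crossing; on Gauss diagrams it interchanges two adjacent tails of two different arrows. $FU$ moves a strand under a virtual crossing; on Gauss diagrams it interchanges two adjacent heads of two different arrows. Signs of arrows are arbitrary and unchanged in both moves. The forbidden number $F(K)$ is the minimum number of forbidden moves needed to transform $K$ into the unknot, taken over all diagrams of $K$ and with unlimited use of extended Reidemeister moves. A classical crossing is odd if, in the Gauss diagram, the number of arrow endpoints lying between the two endpoints of its arrow is odd; otherwise it is even. The odd writhe $w_o(K)$ is the sum of the signs of the odd crossings; it is known (Kauffman) to be an invariant of virtual knots. *)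

(* Defs.v *)
From Stdlib Require Import Relation_Operators.
From HB Require Import structures.
From mathcomp Require Import all_boot all_order all_algebra.
From mathcomp Require Import boolp classical_sets reals constructive_ereal ereal.

Set Implicit Arguments.
Unset Strict Implicit.
Unset Printing Implicit Defensive.

Import Order.TTheory GRing.Theory Num.Theory.

(* An endpoint of an arrow is ((label of the arrow, is it the head?), sign s),
   where s encodes the sign (-1) ^+ s, i.e. [s = true] is a negative crossing.
   Tails are overpasses, heads are underpasses. *)
Definition endpoint : Type := (nat * bool * bool)%type.
Definition label (x : endpoint) : nat := x.1.1.
Definition is_head (x : endpoint) : bool := x.1.2.
Definition neg (x : endpoint) : bool := x.2.
Definition tail_end (a : nat) (s : bool) : endpoint := (a, false, s).
Definition head_end (a : nat) (s : bool) : endpoint := (a, true, s).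
Definition opposite (x : endpoint) : endpoint := (label x, ~~ is_head x, neg x).

(* The endpoints met when travelling once around the oriented circle from a
   base point: each occurring label has exactly one tail and exactly one head,
   and these carry the same sign. *)
Definition is_gauss_word (w : seq endpoint) : bool :=
  uniq [seq (label x, is_head x) | x <- w] && all (fun x => opposite x \in w) w.

Record gauss_diagram : Type := GaussDiagram {
  gauss_word :> seq endpoint;
  gauss_wordP : is_gauss_word gauss_word }.

HB.instance Definition _ := [isSub for gauss_word].
HB.instance Definition _ := [Choice of gauss_diagram by <:].

Definition relabel (f : nat -> nat) (x : endpoint) : endpoint :=
  (f (label x), is_head x, neg x).

Definition ordered (o : bool) (x y : endpoint) : seq endpoint :=
  if o then [:: y; x] else [:: x; y].

(* [gw_rot] and [gw_relabel] forget the base point and the labels, so that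
   words related by them present the same Gauss diagram.  Thanks to [gw_rot]
   the other moves are only written for words starting at one of the affected
   arcs.  Freshness of the labels created by a move is enforced by
   [is_gauss_word], see [same_or_reidemeister].

   [gw_R2]: the two arrows have opposite signs, their tails are adjacent and
   their heads are adjacent, in the same order (parallel strands) or in the
   reverse order (antiparallel strands).

   [gw_R3]: strands 1, 2, 3 are the top, middle and bottom ones; arrow a is the
   crossing of 1 over 2, b of 1 over 3, c of 2 over 3.  For oriented lines with
   directions d_1, d_2, d_3 the sign of the crossing of i over j is that of
   det(d_i, d_j).  If p is the vector from the crossing of 1, 2 to a point of
   line 3, then strand 1 meets a before b iff det(p, d_3) and the sign of b
   agree, strand 2 meets a before c iff det(p, d_3) and the sign of c agree,
   and strand 3 meets b before c iff det(p, d_3) agrees with the product of the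
   three signs.  All eight sign patterns occur, and the move changes the sign
   of det(p, d_3), encoded by e.  The two constructors are the two cyclic
   orders in which the three strands may be traversed. *)
Definition strand1 (e : bool) (a b : nat) (sa sb : bool) : seq endpoint :=
  ordered (e (+) sb) (tail_end a sa) (tail_end b sb).
Definition strand2 (e : bool) (a c : nat) (sa sc : bool) : seq endpoint :=
  ordered (e (+) sc) (head_end a sa) (tail_end c sc).
Definition strand3 (e : bool) (b c : nat) (sa sb sc : bool) : seq endpoint :=
  ordered (e (+) sa (+) sb (+) sc) (head_end b sb) (head_end c sc).

Inductive gauss_move : seq endpoint -> seq endpoint -> Prop :=
| gw_rot (n : nat) (w : seq endpoint) : gauss_move w (rot n w)
| gw_relabel (f : nat -> nat) (w : seq endpoint) :
    injective f -> gauss_move w (map (relabel f) w)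
| gw_R1 (x : endpoint) (w : seq endpoint) :
    gauss_move w ([:: x; opposite x] ++ w)
| gw_R2 (a b : nat) (s o : bool) (u v : seq endpoint) :
    gauss_move (u ++ v)
      ([:: tail_end a s; tail_end b (~~ s)] ++ u
       ++ ordered o (head_end a s) (head_end b (~~ s)) ++ v)
| gw_R3_123 (e : bool) (a b c : nat) (sa sb sc : bool)
    (u v w : seq endpoint) :
    gauss_move
      (strand1 e a b sa sb ++ u ++ strand2 e a c sa sc ++ v
       ++ strand3 e b c sa sb sc ++ w)
      (strand1 (~~ e) a b sa sb ++ u ++ strand2 (~~ e) a c sa sc ++ v
       ++ strand3 (~~ e) b c sa sb sc ++ w)
| gw_R3_132 (e : bool) (a b c : nat) (sa sb sc : bool)
    (u v w : seq endpoint) :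
    gauss_move
      (strand1 e a b sa sb ++ u ++ strand3 e b c sa sb sc ++ v
       ++ strand2 e a c sa sc ++ w)
      (strand1 (~~ e) a b sa sb ++ u ++ strand3 (~~ e) b c sa sb sc ++ v
       ++ strand2 (~~ e) a c sa sc ++ w).

Definition same_or_reidemeister (D D' : gauss_diagram) : Prop :=
  gauss_move D D'.

Definition gauss_equiv (D D' : gauss_diagram) : bool :=
  `[< clos_refl_sym_trans gauss_diagram same_or_reidemeister D D' >].

Lemma gauss_equiv_is_equiv : equiv_class_of gauss_equiv.
Proof.
split=> [D|D D'|D2 D1 D3].
- exact/asboolP/rst_refl.
- by apply/asboolP/asboolP; apply: rst_sym.
- by move=> /asboolP h12 /asboolP h23; apply/asboolP/(rst_trans _ _ _ _ _ h12).
Qed.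

Canonical gauss_equiv_rel : equiv_rel gauss_diagram :=
  EquivRelPack gauss_equiv_is_equiv.

Definition virtual_knot : Type := {eq_quot gauss_equiv}%qT.
HB.instance Definition _ := Choice.on virtual_knot.
HB.instance Definition _ := EqQuotient.on virtual_knot.

Definition knot_of (D : gauss_diagram) : virtual_knot := (\pi_virtual_knot D)%qT.

Definition trivial_diagram : gauss_diagram := @GaussDiagram [::] isT.
Definition unknot : virtual_knot := knot_of trivial_diagram.

Inductive forbidden_move : seq endpoint -> seq endpoint -> Prop :=
| forbidden_FO (a b : nat) (s t : bool) (w : seq endpoint) :
    forbidden_move ([:: tail_end a s; tail_end b t] ++ w)
      ([:: tail_end b t; tail_end a s] ++ w)
| forbidden_FU (a b : nat) (s t : bool) (w : seq endpoint) :
    forbidden_move ([:: head_end a s; head_end b t] ++ w)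
      ([:: head_end b t; head_end a s] ++ w).

Definition forbidden_step (K K' : virtual_knot) : Prop :=
  exists D D' : gauss_diagram,
    [/\ knot_of D = K, knot_of D' = K' & forbidden_move D D'].

(* Extended Reidemeister moves are free of charge, since the steps are between
   virtual knots and not between diagrams. *)
Fixpoint forbidden_path (n : nat) (K K' : virtual_knot) : Prop :=
  if n is m.+1
  then exists2 K1, forbidden_step K K1 & forbidden_path m K1 K'
  else K = K'.

(* Forbidden moves unknot every virtual knot, so that the set is nonempty and
   the infimum is a minimum; it would be [+oo] for the empty set. *)
Definition forbidden_number (R : realType) (K : virtual_knot) : \bar R :=
  ereal_inf [set (n%:R)%:E | n in [set n | forbidden_path n K unknot]]%classic%R.

Definition endpoints_between (w : seq endpoint) (x y : endpoint) : nat :=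
  (maxn (index x w) (index y w) - minn (index x w) (index y w)).-1.

(* The two arcs cut out by an arrow contain endpoints in numbers of the same
   parity, so the choice of the arc does not matter. *)
Definition odd_arrow (w : seq endpoint) (x : endpoint) : bool :=
  odd (endpoints_between w x (opposite x)).

(* Each arrow is counted once, through its tail. *)
Definition odd_writhe (D : gauss_diagram) : int :=
  (\sum_(x <- gauss_word D | ~~ is_head x && odd_arrow D x) (-1) ^+ neg x)%R.

(* Main.v *)
Require Import Defs.
From mathcomp Require Import all_boot all_order all_algebra.
From mathcomp Require Import reals constructive_ereal.
From mathcomp Require Import boolp ereal.
From mathcomp Require Import zify.

Set Implicit Arguments.
Unset Strict Implicit.
Unset Printing Implicit Defensive.

Import Order.TTheory GRing.Theory Num.Theory.

(** The odd writhe is a knot invariant, it vanishes on the unknot, and one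
    forbidden move changes it by at most 2; hence n forbidden moves that unknot
    K force [|w_o(K)| <= 2 n].

    All this is read off the parities of the positions of the endpoints on the
    circle.  An arrow is odd iff its two endpoints sit at positions of the same
    parity ([odd_arrowE]), so only those parities have to be followed, and they
    react to moves in two simple ways.  Removing or inserting adjacent pairs of
    endpoints does not affect the remaining parities, which settles R1 and R2:
    the new arrow of R1 is even, and the two new arrows of R2 have the same
    parity and opposite signs.  Exchanging two adjacent endpoints toggles
    exactly their two parities ([position_parity_swap]).  R3 performs three
    such exchanges, which together involve both endpoints of each of its three
    arrows, so every arrow keeps its parity.  A forbidden move performs a single
    exchange, of one endpoint of each of two distinct arrows: these two arrows
    change parity, and each of them contributes at most 1 in absolute value to
    the change of the odd writhe.  Rotating the base point toggles either all
    parities or none, because a Gauss word has even length. *)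

(** * Gauss words *)

Lemma oppositeK : involutive opposite.
Proof. by case=> [[a h] s]; rewrite /opposite /= negbK. Qed.

Lemma opposite_neq x : (opposite x == x) = false.
Proof.
by case: x => [[a h] s]; rewrite /opposite /= !xpair_eqE /=; case: h; rewrite andbF.
Qed.

Lemma gauss_word_uniq w : is_gauss_word w -> uniq w.
Proof. by case/andP=> /map_uniq. Qed.

Lemma gauss_word_opposite w x : is_gauss_word w -> (opposite x \in w) = (x \in w).
Proof.
case/andP=> _ /allP ow; apply/idP/idP => [/ow|/ow //].
by rewrite oppositeK.
Qed.

(** Reversing the role of the two endpoints of each arrow permutes the word, so
    there are as many heads as tails. *)
Lemma gauss_word_size_even w : is_gauss_word w -> odd (size w) = false.
Proof.
move=> gw; have uw := gauss_word_uniq gw.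
have pw : perm_eq (map opposite w) w.
  have oppI := inv_inj oppositeK.
  apply: uniq_perm => // [|x]; first by rewrite map_inj_uniq.
  by rewrite -[x in LHS]oppositeK mem_map ?gauss_word_opposite.
have /permP/(_ is_head) := pw.
rewrite count_map => eqc; rewrite -(count_predC is_head) -eqc.
by rewrite (eq_count (a2 := predC is_head)) ?addnn ?odd_double.
Qed.

(** * Parity of arrows and positions of their endpoints *)

Definition position_parity (w : seq endpoint) (x : endpoint) : bool :=
  odd (index x w).

(** Endpoints at positions i < j have j - i - 1 endpoints between them. *)
Lemma odd_arrowE w x : is_gauss_word w -> x \in w ->
  odd_arrow w x = ~~ (position_parity w x (+) position_parity w (opposite x)).
Proof.
move=> gw xw; rewrite /odd_arrow /endpoints_between /position_parity.
have oxw : opposite x \in w by rewrite gauss_word_opposite.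
have ne : index x w != index (opposite x) w.
  apply/eqP => /(congr1 (nth x w)); rewrite !nth_index // => /eqP.
  by rewrite eq_sym opposite_neq.
move: (index x w) (index (opposite x) w) ne => i j.
wlog lt_ij : i j / (i < j)%N => [hw|_].
  rewrite neq_ltn => /orP[] lt; first by rewrite hw ?neq_ltn ?lt.
  by rewrite maxnC minnC addbC hw ?neq_ltn ?lt.
rewrite (maxn_idPr (ltnW lt_ij)) (minn_idPl (ltnW lt_ij)).
have d_gt0 : (0 < j - i)%N by rewrite subn_gt0.
by rewrite addbC -oddB 1?ltnW // -(prednK d_gt0) /= negbK.
Qed.

Definition writhe_term (w : seq endpoint) (x : endpoint) : int :=
  (if ~~ is_head x && odd_arrow w x then (-1) ^+ neg x else 0)%R.

Lemma odd_writheE (D : gauss_diagram) :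
  odd_writhe D = (\sum_(x <- gauss_word D) writhe_term D x)%R.
Proof. by rewrite /odd_writhe big_mkcond. Qed.

(** Toggling both endpoints of an arrow leaves its parity unchanged. *)
Lemma writhe_term_eq w w' b x : is_gauss_word w -> is_gauss_word w' ->
    x \in w -> x \in w' ->
    position_parity w' x = position_parity w x (+) b ->
    position_parity w' (opposite x) = position_parity w (opposite x) (+) b ->
  writhe_term w' x = writhe_term w x.
Proof.
move=> gw gw' xw xw' px pox; rewrite /writhe_term !odd_arrowE // px pox.
by rewrite addbACA addbb addbF.
Qed.

(** The common principle behind rotations and R3: [b] records the endpoints
    whose position changes parity, and it is required to take whole arrows. *)
Lemma odd_writhe_toggle (D D' : gauss_diagram) (b : endpoint -> bool) :
    perm_eq D D' -> (forall x, b (opposite x) = b x) ->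
    {in gauss_word D, forall x,
      position_parity D' x = position_parity D x (+) b x} ->
  odd_writhe D' = odd_writhe D.
Proof.
move=> pDD' bo pD; rewrite !odd_writheE -(perm_big _ pDD') /=.
rewrite big_seq [RHS]big_seq; apply: eq_bigr => x xD.
apply: (writhe_term_eq (b := b x)); rewrite ?gauss_wordP -?(perm_mem pDD') //;
  first exact: pD.
by rewrite -bo pD // gauss_word_opposite ?gauss_wordP.
Qed.

Lemma perm_ordered o o' y z : perm_eq (ordered o y z) (ordered o' y z).
Proof. by case: o; case: o'; rewrite ?perm_refl // (perm_catC [:: _] [:: _]). Qed.

Lemma perm_swap p o o' y z s :
  perm_eq (p ++ ordered o y z ++ s) (p ++ ordered o' y z ++ s).
Proof. by rewrite perm_cat2l perm_cat2r perm_ordered. Qed.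

Lemma position_parity_adjacent p o y z s : uniq (p ++ ordered o y z ++ s) ->
  position_parity (p ++ ordered o y z ++ s) z =
  ~~ position_parity (p ++ ordered o y z ++ s) y.
Proof.
rewrite (perm_uniq (perm_swap p o false y z s)) cat_uniq /= inE !negb_or.
case/and5P=> _ /and3P[yp zp _] /andP[/negbTE yz _] _ _.
rewrite /position_parity !index_cat (negbTE yp) (negbTE zp) !oddD -addbN.
congr (_ (+) _); have zy : (z == y) = false by rewrite eq_sym.
by case: o; rewrite /= !inE !eqxx ?yz ?zy /= ?eqxx ?yz ?zy.
Qed.

(** Stating the toggled set as an exclusive or, rather than as membership in
    [[:: y; z]], lets several swaps be composed by boolean algebra alone. *)
Lemma position_parity_swap p o y z s x : uniq (p ++ ordered o y z ++ s) ->
  position_parity (p ++ ordered (~~ o) y z ++ s) x =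
  position_parity (p ++ ordered o y z ++ s) x (+) ((x == y) (+) (x == z)).
Proof.
rewrite (perm_uniq (perm_swap p o false y z s)) /= uniq_catC cat_uniq /=.
rewrite !inE !negb_or => /and3P[/and3P[/andP[/negbTE yz _] _ _] /hasPn dis _].
rewrite /position_parity !index_cat; case: ifP => xp.
  have := dis _ xp; rewrite !inE !negb_or => /and3P[/negbTE-> /negbTE-> _].
  by rewrite !addbF.
rewrite !oddD -addbA; congr (_ (+) _).
have zy : (z == y) = false by rewrite eq_sym.
have [->|xy] := eqVneq x y; last have [->|xz] := eqVneq x z.
- by case: o; rewrite /= !inE ?eqxx yz ?zy ?eqxx.
- by case: o; rewrite /= !inE ?eqxx yz ?zy ?eqxx.
- by case: o; rewrite /= !inE (negbTE xy) (negbTE xz) addbF.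
Qed.

(** * Invariance under the Reidemeister moves *)

Lemma odd_writhe_rot n (D D' : gauss_diagram) :
  gauss_word D' = rot n D -> odd_writhe D' = odd_writhe D.
Proof.
move=> DE'; have := gauss_word_size_even (gauss_wordP D).
have := gauss_word_uniq (gauss_wordP D).
have := cat_take_drop n D; move: DE'; rewrite /rot.
move: (take n D) (drop n D) => u v DE' /esym DE.
rewrite DE cat_uniq size_cat oddD => /and3P[_ /hasPn dis _] sz_even.
(* Endpoints of [u] move by [size v], those of [v] by [size u], and these two
   numbers have the same parity. *)
apply: (@odd_writhe_toggle _ _ (fun=> odd (size v))) => // [|x].
  by rewrite DE DE' perm_catC.
rewrite DE' DE mem_cat /position_parity !index_cat.
have [xv _|_] := boolP (x \in v); last first.
  by rewrite orbF => ->; rewrite oddD addbC.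
have -> : (x \in u) = false by apply/negbTE/dis.
by rewrite oddD addbC addbA [odd (size v) (+) _]addbC sz_even.
Qed.

Lemma odd_writhe_relabel f (D D' : gauss_diagram) : injective f ->
  gauss_word D' = map (relabel f) D -> odd_writhe D' = odd_writhe D.
Proof.
move=> fI DE; have rI : injective (relabel f).
  by case=> [[a h] s] [[b i] t]; rewrite /relabel /label /is_head /neg /=
    => -[/fI -> -> ->].
rewrite !odd_writheE DE big_map; apply: eq_bigr => x _.
by rewrite /writhe_term /odd_arrow /endpoints_between
  (_ : opposite (relabel f x) = relabel f (opposite x)) // !index_map.
Qed.

(** The common principle behind R1 and R2, whose new endpoints come in adjacent
    pairs and so shift the old ones by even amounts. *)
Lemma odd_writhe_insert new (D D' : gauss_diagram) :
    perm_eq D' (new ++ D) ->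
    (\sum_(x <- new) writhe_term D' x = 0)%R ->
    {in gauss_word D, position_parity D' =1 position_parity D} ->
  odd_writhe D' = odd_writhe D.
Proof.
move=> pD' new0 par; have gD := gauss_wordP D.
rewrite !odd_writheE (perm_big _ pD') big_cat new0 /= add0r.
rewrite big_seq [RHS]big_seq; apply: eq_bigr => y yD.
apply: (writhe_term_eq (b := false)); rewrite ?gauss_wordP ?addbF //.
- by rewrite (perm_mem pD') mem_cat yD orbT.
- exact: par.
- by apply: par; rewrite gauss_word_opposite.
Qed.

Lemma odd_writhe_R1 x (D D' : gauss_diagram) :
  gauss_word D' = [:: x; opposite x] ++ D -> odd_writhe D' = odd_writhe D.
Proof.
move=> DE; have gD' := gauss_wordP D'; have uD' := gauss_word_uniq gD'.
have flip : position_parity D' (opposite x) = ~~ position_parity D' x.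
  by move: uD'; rewrite DE => /(@position_parity_adjacent [::] false).
apply: (@odd_writhe_insert [:: x; opposite x]); first by rewrite DE.
  have new y : y \in [:: x; opposite x] -> y \in gauss_word D'.
    by move=> yx; rewrite DE mem_cat yx.
  rewrite big_cons big_seq1 /writhe_term !odd_arrowE ?new ?inE ?eqxx ?orbT //.
  by rewrite oppositeK flip addbN addNb addbb !andbF addr0.
move=> z zD; rewrite DE /position_parity index_cat ifN ?oddD //.
by move: uD'; rewrite DE cat_uniq => /and3P[_ /hasPn/(_ _ zD)].
Qed.

(** In both pairs the endpoint of [b] has the other parity than that of [a],
    whatever the order of the heads; so the two arrows have the same parity and
    their opposite signs cancel. *)
Lemma odd_writhe_R2 a b s o u v (D D' : gauss_diagram) :
    gauss_word D = u ++ v ->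
    gauss_word D' = [:: tail_end a s; tail_end b (~~ s)] ++ u
       ++ ordered o (head_end a s) (head_end b (~~ s)) ++ v ->
  odd_writhe D' = odd_writhe D.
Proof.
move=> DE DE'; have gD' := gauss_wordP D'; have uD' := gauss_word_uniq gD'.
set tails := [:: _; _] in DE'; set heads := ordered _ _ _ in DE'.
have pD' : perm_eq D' ((tails ++ heads) ++ D).
  by rewrite DE' DE -catA perm_cat2l perm_catCA.
apply: (odd_writhe_insert pD'); last first.
  move=> z zD; have : z \notin tails ++ heads.
    by move: uD'; rewrite (perm_uniq pD') cat_uniq => /and3P[_ /hasPn/(_ _ zD)].
  rewrite mem_cat => /norP[zt zh].
  rewrite DE DE' /position_parity index_cat (negbTE zt) !index_cat (negbTE zh).
  have -> : size heads = 2 by rewrite /heads; case: (o).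
  by case: ifP; rewrite !oddD.
have new y : y \in tails ++ heads -> y \in gauss_word D'.
  by move=> yn; rewrite (perm_mem pD') mem_cat yn.
rewrite big_cat /= (perm_big _ (perm_ordered o false _ _)) /= !big_cons !big_nil.
rewrite /writhe_term /= !addr0 !odd_arrowE ?new ?mem_cat ?inE ?eqxx ?orbT //.
rewrite /opposite /= -/(head_end a s) -/(head_end b (~~ s)).
have -> : position_parity D' (head_end b (~~ s)) =
    ~~ position_parity D' (head_end a s).
  rewrite DE' catA position_parity_adjacent //.
  by move: uD'; rewrite DE' catA.
have -> : position_parity D' (tail_end b (~~ s)) =
    ~~ position_parity D' (tail_end a s).
  by move: uD'; rewrite DE' => /(@position_parity_adjacent [::] false).
rewrite addbN addNb negbK /neg /=; case: ifP => _; last by rewrite addr0.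
by case: (s).
Qed.

(** R3 for both cyclic orders of the strands.  The three swaps are made one
    after the other, so that each one is an instance of [position_parity_swap]
    with prefix [[::]], [p2] and [p3] in turn. *)
Lemma odd_writhe_three_swaps o1 o2 o3 y1 z1 y2 z2 y3 z3 u v w
    (D D' : gauss_diagram) :
    let toggled x := (x == y1) (+) (x == z1) (+) ((x == y2) (+) (x == z2))
                     (+) ((x == y3) (+) (x == z3)) in
    (forall x, toggled (opposite x) = toggled x) ->
    gauss_word D = ordered o1 y1 z1 ++ u ++ ordered o2 y2 z2 ++ v
                   ++ ordered o3 y3 z3 ++ w ->
    gauss_word D' = ordered (~~ o1) y1 z1 ++ u ++ ordered (~~ o2) y2 z2 ++ v
                    ++ ordered (~~ o3) y3 z3 ++ w ->
  odd_writhe D' = odd_writhe D.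
Proof.
move=> toggled closed DE DE'; have u1 := gauss_word_uniq (gauss_wordP D).
pose p2 := ordered (~~ o1) y1 z1 ++ u.
pose p3 := p2 ++ ordered (~~ o2) y2 z2 ++ v.
pose s2 := v ++ ordered o3 y3 z3 ++ w.
pose s1 := u ++ ordered o2 y2 z2 ++ s2.
have E1 : [::] ++ ordered (~~ o1) y1 z1 ++ s1 = p2 ++ ordered o2 y2 z2 ++ s2.
  by rewrite /p2 /s1 -!catA.
have E2 : p2 ++ ordered (~~ o2) y2 z2 ++ s2 = p3 ++ ordered o3 y3 z3 ++ w.
  by rewrite /p3 /s2 -!catA.
have {}DE : gauss_word D = [::] ++ ordered o1 y1 z1 ++ s1 by [].
have {}DE' : gauss_word D' = p3 ++ ordered (~~ o3) y3 z3 ++ w.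
  by rewrite DE' /p3 /p2 -!catA.
have perm1 := perm_swap [::] o1 (~~ o1) y1 z1 s1.
have perm2 := perm_swap p2 o2 (~~ o2) y2 z2 s2.
have perm3 := perm_swap p3 o3 (~~ o3) y3 z3 w.
rewrite E1 in perm1; rewrite E2 in perm2.
rewrite DE in u1; have u2 := u1; rewrite (perm_uniq perm1) in u2.
have u3 := u2; rewrite (perm_uniq perm2) in u3.
apply: (@odd_writhe_toggle _ _ toggled) => // [|x _].
  by rewrite DE DE' (perm_trans perm1) // (perm_trans perm2).
rewrite DE DE' position_parity_swap // -E2 position_parity_swap //.
by rewrite -E1 position_parity_swap // /toggled !addbA.
Qed.

Lemma odd_writhe_gauss_move (D D' : gauss_diagram) :
  gauss_move D D' -> odd_writhe D' = odd_writhe D.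
Proof.
move=> mv; have [W DE] : {W | gauss_word D = W} by exists D.
have [W' DE'] : {W' | gauss_word D' = W'} by exists D'.
rewrite DE DE' in mv.
case: mv DE DE' => [n w|f w fI|x w|a b s o u v|e a b c sa sb sc u v w
  |e a b c sa sb sc u v w] DE DE'.
- by apply: (@odd_writhe_rot n); rewrite DE.
- by apply: (odd_writhe_relabel fI); rewrite DE.
- by apply: (@odd_writhe_R1 x); rewrite DE.
- exact: (odd_writhe_R2 DE DE').
(* For R3 the six swapped endpoints are the tail and the head of each of
   a, b, c. *)
- rewrite /strand1 /strand2 /strand3 !addNb in DE'.
  apply: (odd_writhe_three_swaps _ DE DE') => -[[l h] t].
  rewrite /opposite /label /is_head /neg /= !xpair_eqE.
  by case: h; do 3!case: (l == _); do 3!case: (t == _).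
- rewrite /strand1 /strand2 /strand3 !addNb in DE'.
  apply: (odd_writhe_three_swaps _ DE DE') => -[[l h] t].
  rewrite /opposite /label /is_head /neg /= !xpair_eqE.
  by case: h; do 3!case: (l == _); do 3!case: (t == _).
Qed.

Lemma odd_writhe_knot (D D' : gauss_diagram) :
  knot_of D = knot_of D' -> odd_writhe D = odd_writhe D'.
Proof.
move=> /eqmodP/asboolP; elim=> {D D'} //.
- by move=> D D' /odd_writhe_gauss_move.
- by move=> D1 D2 D3 _ -> _ ->.
Qed.

(** * Effect of a forbidden move *)

Lemma writhe_term_dist w w' x : (`|writhe_term w' x - writhe_term w x| <= 1)%R.
Proof.
rewrite /writhe_term; case: (~~ _) => //=.
by case: (odd_arrow w' x); case: (odd_arrow w x); case: (neg x).
Qed.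

Lemma odd_writhe_dist (D D' : gauss_diagram) y z : perm_eq D D' ->
    {in gauss_word D, forall x, x \notin [:: y; z] ->
      writhe_term D' x = writhe_term D x} ->
  (`|odd_writhe D' - odd_writhe D| <= 2)%R.
Proof.
move=> pDD' eqD; rewrite !odd_writheE -(perm_big _ pDD') /= -sumrB.
apply: (le_trans (ler_norm_sum _ _ _)).
rewrite (bigID (mem [:: y; z])) /= [X in (_ + X)%R]big1_seq ?addr0; last first.
  by move=> x /andP[xn xD]; rewrite eqD // subrr normr0.
rewrite -big_filter; apply: (le_trans (ler_sum _ (fun x _ => writhe_term_dist _ _ _))).
rewrite big_const_seq count_predT iter_addr_0 -mulr_natl mulr1 ler_nat.
rewrite (@uniq_leq_size _ _ [:: y; z]) ?filter_uniq ?gauss_word_uniq ?gauss_wordP //.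
by move=> x; rewrite mem_filter => /andP[].
Qed.

(** The swapped endpoints are both tails or both heads, so they lie on distinct
    arrows, and only these two arrows can change parity. *)
Lemma odd_writhe_forbidden_move (D D' : gauss_diagram) :
  forbidden_move D D' -> (`|odd_writhe D' - odd_writhe D| <= 2)%R.
Proof.
have swapped (y z : endpoint) w : is_head y = is_head z ->
    gauss_word D = [:: y; z] ++ w -> gauss_word D' = [:: z; y] ++ w ->
  (`|odd_writhe D' - odd_writhe D| <= 2)%R.
  move=> yz DE DE'; have uD := gauss_word_uniq (gauss_wordP D).
  have pDD' : perm_eq D D'.
    by rewrite DE DE'; exact: (perm_swap [::] false true).
  (* The odd writhe counts arrows by their tails: the swapped endpoints are
     replaced with the tails of their arrows. *)
  pose tail x := if is_head x then opposite x else x.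
  apply: (@odd_writhe_dist _ _ (tail y) (tail z)) => // x xD.
  rewrite !inE => /norP[xy xz].
  rewrite DE in uD.
  have toggle t : position_parity D' t =
      position_parity D t (+) ((t == y) (+) (t == z)).
    by rewrite DE DE' (position_parity_swap (p := [::]) (o := false)).
  rewrite /writhe_term; case hx: (is_head x) => //=.
  have gD := gauss_wordP D; have gD' := gauss_wordP D'.
  have nt t : is_head t = is_head y -> x != tail t ->
      (x == t) = false /\ (opposite x == t) = false.
    move=> ty; rewrite /tail ty; case: ifP => hy /negbTE xt; split=> //.
    - by apply: contraFF hx => /eqP ->; rewrite ty.
    - by rewrite -xt (inv_eq oppositeK).
    - apply/eqP => xt'; move: ty; rewrite -xt' hy /is_head /= => /negbFE.
      by rewrite -/(is_head x) hx.
  have [xy1 xy2] := nt y erefl xy; have [xz1 xz2] := nt z (esym yz) xz.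
  by rewrite !odd_arrowE -?(perm_mem pDD') // !toggle xy1 xy2 xz1 xz2 !addbF.
move=> mv; have [W DE] : {W | gauss_word D = W} by exists D.
have [W' DE'] : {W' | gauss_word D' = W'} by exists D'.
rewrite DE DE' in mv.
by case: mv DE DE' => a b s t w; apply: swapped.
Qed.

(** * The lower bound *)

Lemma odd_writhe_forbidden_path n (D : gauss_diagram) :
  forbidden_path n (knot_of D) unknot -> (`|odd_writhe D| <= n.*2%:Z)%R.
Proof.
elim: n D => [|n IHn] D /=.
  by move/odd_writhe_knot->; rewrite /odd_writhe big_nil normr0.
case=> K1 [D1 [D2 [DD1 <- mv]]] /IHn le_n.
rewrite -(odd_writhe_knot DD1).
have := odd_writhe_forbidden_move mv; lia.
Qed.

Theorem theorem9 (R : realType) (K : virtual_knot) (D : gauss_diagram)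
    (hD : knot_of D = K) :
  ((`|2^-1 * (odd_writhe D)%:~R|%R)%:E <= forbidden_number R K)%E.
Proof.
apply: le_ereal_inf_tmp => _ [n path_n <-]; rewrite lee_fin.
rewrite -hD in path_n; have := odd_writhe_forbidden_path path_n.
rewrite -(ler_int R) intr_norm -muln2 PoszM intrM => le_n.
by rewrite normrM ger0_norm ?invr_ge0 // ler_pdivrMl // mulrC.
Qed.
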